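(* Let $P, Q$ be two microCCS processes. Then $P\sim Q$ if and only if $\mathrm{nf}(P)\equiv \mathrm{nf}(Q)$, where $\mathrm{nf}(R)$ denotes the normal form of $R$ with respect to the distribution rewriting relation $\rightarrow_d$.
   Context: Fix an infinite set of names $a,b,\dots$. MicroCCS processes are given by $\eta ::= a \mid \overline{a}$ and $P ::= \mathbf{0} \mid \eta.P \mid P\,|\,Q$, with $\overline{\overline{a}}=a$. Structural congruence $\equiv$ is the smallest congruence satisfying $P|Q\equiv Q|P$, $P|(Q|R)\equiv (P|Q)|R$, $P|\mathbf{0}\equiv P$. The labelled transition system has actions $\mu ::= \eta \mid \tau$ and rules: $\eta.P\xrightarrow{\eta}P$; if $P\xrightarrow{\eta}P'$ and $Q\xrightarrow{\overline{\eta}}Q'$ then $P|Q\xrightarrow{\tau}P'|Q'$; if $P\xrightarrow{\mu}P'$ then $P|Q\xrightarrow{\mu}P'|Q$ and $Q|P\xrightarrow{\mu}Q|P'$. A bisimulation is a symmetric relation $\mathcal R$ such that $P\mathcal R Q$ and $P\xrightarrow{\mu}P'$ imply $Q\xrightarrow{\mu}Q'$ with $P'\mathcal R Q'$ for some $Q'$; bisimilarity $\sim$ is the union of all bisimulations. Write $R^k$ for the parallel composition of $k$ copies of $R$. The relation $P\rightarrow_d P'$ holds when there are $P_1,P_2$ with $P\equiv P_1$, $P_2\equiv P'$, and $P_2$ is obtained from $P_1$ by replacing a subterm of the form $\eta.(R\,|\,(\eta.R)^k)$, for some $k\geq 1$, by $(\eta.R)^{k+1}$. The relation $\rightarrow_d$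 is strongly normalising and confluent, so every $P$ has a normal form $\mathrm{nf}(P)$, unique up to $\equiv$. *)

(* Defs.v *)
From Stdlib Require Import Relations Arith Lia Classical ClassicalEpsilon.

Inductive prefix (name : Type) : Type :=
| input (a : name)
| output (a : name).

Arguments input {name} a.
Arguments output {name} a.

Definition co {name : Type} (eta : prefix name) : prefix name :=
  match eta with
  | input a => output a
  | output a => input a
  end.

Inductive process (name : Type) : Type :=
| inert
| pre (eta : prefix name) (P : process name)
| par (P Q : process name).

Arguments inert {name}.
Arguments pre {name} eta P.
Arguments par {name} P Q.

Inductive struct_cong {name : Type} : process name -> process name -> Prop :=
| sc_refl P : struct_cong P P
| sc_sym P Q : struct_cong P Q -> struct_cong Q P
| sc_trans P Q R : struct_cong P Q -> struct_cong Q R -> struct_cong P R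
| sc_pre eta P Q : struct_cong P Q -> struct_cong (pre eta P) (pre eta Q)
| sc_par P P' Q Q' :
    struct_cong P P' -> struct_cong Q Q' -> struct_cong (par P Q) (par P' Q')
| sc_par_comm P Q : struct_cong (par P Q) (par Q P)
| sc_par_assoc P Q R : struct_cong (par P (par Q R)) (par (par P Q) R)
| sc_par_inert P : struct_cong (par P inert) P.

Inductive action (name : Type) : Type :=
| visible (eta : prefix name)
| tau.

Arguments visible {name} eta.
Arguments tau {name}.

Inductive step {name : Type} :
  process name -> action name -> process name -> Prop :=
| step_pre eta P : step (pre eta P) (visible eta) P
| step_comm eta P P' Q Q' :
    step P (visible eta) P' -> step Q (visible (co eta)) Q' ->
    step (par P Q) tau (par P' Q')
| step_par_l mu P P' Q : step P mu P' -> step (par P Q) mu (par P' Q)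
| step_par_r mu P P' Q : step P mu P' -> step (par Q P) mu (par Q P').

Definition bisimulation {name : Type} (R : relation (process name)) : Prop :=
  symmetric _ R /\
  forall P Q mu P', R P Q -> step P mu P' ->
    exists Q', step Q mu Q' /\ R P' Q'.

Definition bisimilar {name : Type} (P Q : process name) : Prop :=
  exists R, bisimulation R /\ R P Q.

(* The trailing [inert] is immaterial: [copies] is only used in [dist], which is
   closed under [struct_cong] on both sides. *)
Fixpoint copies {name : Type} (k : nat) (R : process name) : process name :=
  match k with
  | 0 => inert
  | S k => par R (copies k R)
  end.

(* Replacement of exactly one subterm, at any depth. *)
Inductive dist_subterm {name : Type} : relation (process name) :=
| dist_here eta R k : 1 <= k ->
    dist_subterm (pre eta (par R (copies k (pre eta R))))
                 (copies (k + 1) (pre eta R))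
| dist_pre eta P P' : dist_subterm P P' -> dist_subterm (pre eta P) (pre eta P')
| dist_par_l P P' Q : dist_subterm P P' -> dist_subterm (par P Q) (par P' Q)
| dist_par_r P P' Q : dist_subterm P P' -> dist_subterm (par Q P) (par Q P').

Definition dist {name : Type} (P P' : process name) : Prop :=
  exists P1 P2, struct_cong P P1 /\ dist_subterm P1 P2 /\ struct_cong P2 P'.

Definition dist_normal_form {name : Type} (P N : process name) : Prop :=
  clos_refl_trans _ dist P N /\ forall N', ~ dist N N'.

Fixpoint size {name : Type} (P : process name) : nat :=
  match P with
  | inert => 0
  | pre _ P => S (size P)
  | par P Q => size P + size Q
  end.

(* The sum of the nesting depths of all prefixes. *)
Fixpoint depth_sum {name : Type} (P : process name) : nat :=
  match P with
  | inert => 0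
  | pre _ P => size P + depth_sum P
  | par P Q => depth_sum P + depth_sum Q
  end.

Lemma struct_cong_measures {name : Type} (P Q : process name) :
  struct_cong P Q -> size P = size Q /\ depth_sum P = depth_sum Q.
Proof. induction 1; simpl; lia. Qed.

Lemma size_copies {name : Type} k (R : process name) :
  size (copies k R) = k * size R.
Proof. induction k; simpl; lia. Qed.

Lemma depth_sum_copies {name : Type} k (R : process name) :
  depth_sum (copies k R) = k * depth_sum R.
Proof. induction k; simpl; lia. Qed.

Lemma dist_subterm_measures {name : Type} (P Q : process name) :
  dist_subterm P Q -> size P = size Q /\ depth_sum Q < depth_sum P.
Proof.
  induction 1; simpl; rewrite ?size_copies, ?depth_sum_copies; simpl; nia.
Qed.

Lemma dist_depth_sum {name : Type} (P Q : process name) :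
  dist P Q -> depth_sum Q < depth_sum P.
Proof.
  intros (P1 & P2 & H1 & H2 & H3).
  apply struct_cong_measures in H1, H3.
  apply dist_subterm_measures in H2.
  lia.
Qed.

Lemma dist_strongly_normalising {name : Type} :
  well_founded (fun P' P : process name => dist P P').
Proof.
  intros P.
  induction P as [P IH] using (well_founded_induction (well_founded_ltof _ depth_sum)).
  constructor. intros P' HP. apply IH, dist_depth_sum, HP.
Qed.

Lemma dist_normal_form_exists {name : Type} (P : process name) :
  exists N, dist_normal_form P N.
Proof.
  induction P as [P IH] using (well_founded_induction dist_strongly_normalising).
  destruct (classic (exists P', dist P P')) as [[P' HP] | H].
  - destruct (IH P' HP) as (N & HN & Hirr).
    exists N. split; [| exact Hirr].
    apply rt_trans with P'; [now apply rt_step | exact HN].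
  - exists P. split; [apply rt_refl |].
    intros N' HN'. apply H. now exists N'.
Qed.

(* A chosen normal form; any two normal forms of [P] are structurally
   congruent, so the choice matters only up to [struct_cong]. *)
Definition nf {name : Type} (P : process name) : process name :=
  proj1_sig (constructive_indefinite_description _ (dist_normal_form_exists P)).

Lemma nf_spec {name : Type} (P : process name) : dist_normal_form P (nf P).
Proof.
  exact (proj2_sig (constructive_indefinite_description _ (dist_normal_form_exists P))).
Qed.

(* Main.v *)
(** Normal forms are closed under visible transitions, so by induction on size
    two bisimilar normal forms [P] and [Q] have the same visible derivatives up
    to [struct_cong].  Regard processes as multisets of prefixed factors, and
    suppose that [t] is a largest factor whose multiplicities differ, say with
    more copies in [P].
    - If [P] has factors other than [t], fire the one whose continuation holds
      the most copies of [t].  To answer, [Q] must fire a factor whose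
      continuation holds even more; being larger than [t], that factor also
      occurs in [P], which contradicts maximality.
    - Otherwise [P] is a power of [t].  Comparing multiplicities of [t] after a
      transition of [Q] shows that [P] is [t] itself and that [t] does not occur
      in [Q].  All the derivatives of [Q] are then congruent, so that [Q] is a
      power of some [pre eta V], and [t] is a redex.
    Only visible transitions are used, so communication plays no role here. *)
Require Import Defs.
From Stdlib Require Import FinFun.
From Stdlib Require Import Relations Arith Lia Classical ClassicalEpsilon.
From Stdlib Require Import Setoid Morphisms.

(** * Structural congruence and transitions *)

#[local] Instance struct_cong_equivalence {name : Type} :
  Equivalence (@struct_cong name).
Proof.
  split; [exact sc_refl | exact sc_sym | exact sc_trans].
Qed.

#[local] Instance pre_proper {name : Type} (eta : prefix name) :
  Proper (struct_cong ==> struct_cong) (pre eta).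
Proof. intros P Q; apply sc_pre. Qed.

#[local] Instance par_proper {name : Type} :
  Proper (struct_cong ==> struct_cong ==> struct_cong) (@par name).
Proof. intros P P' HP Q Q' HQ; now apply sc_par. Qed.

Lemma par_left_comm {name : Type} (P Q R : process name) :
  struct_cong (par P (par Q R)) (par Q (par P R)).
Proof.
  now rewrite sc_par_assoc, (sc_par_comm P Q), <- sc_par_assoc.
Qed.

Lemma co_involutive {name : Type} (eta : prefix name) : co (co eta) = eta.
Proof. now destruct eta. Qed.

Lemma co_neq {name : Type} (eta : prefix name) : co eta <> eta.
Proof. now destruct eta. Qed.

#[local] Hint Constructors step : ccs.
#[local] Hint Resolve sc_refl sc_pre sc_par sc_par_comm sc_par_assoc
  sc_par_inert : sc.
#[local] Hint Immediate sc_sym : sc.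

Ltac match_step :=
  eexists; split; [solve [eauto 4 with ccs] | solve [auto 4 with sc]].

Ltac invert_steps :=
  repeat match goal with
  | H : step inert _ _ |- _ => inversion H; clear H; subst
  | H : step (pre _ _) _ _ |- _ => inversion H; clear H; subst
  | H : step (par _ _) _ _ |- _ => inversion H; clear H; subst
  end.

(** Both directions go through one induction, since the symmetry case exchanges them. *)
Lemma struct_cong_step_both {name : Type} (P Q : process name) :
  struct_cong P Q ->
  (forall mu P', step P mu P' -> exists Q', step Q mu Q' /\ struct_cong P' Q') /\
  (forall mu Q', step Q mu Q' -> exists P', step P mu P' /\ struct_cong P' Q').
Proof.
  induction 1 as [P | P Q H [IH1 IH2] | P Q R H1 [IH1 IH2] H2 [IH3 IH4]
    | eta P Q H [IH1 IH2] | P P' Q Q' H1 [IH1 IH2] H2 [IH3 IH4]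
    | P Q | P Q R | P].
  - split; intros mu X HX; match_step.
  - split; intros mu X HX; [apply IH2 in HX | apply IH1 in HX];
      destruct HX as (Y & HY & HXY); match_step.
  - split; intros mu X HX.
    + apply IH1 in HX as (Y & HY & HXY). apply IH3 in HY as (Z & HZ & HYZ).
      exists Z. split; [exact HZ | now rewrite HXY].
    + apply IH4 in HX as (Y & HY & HXY). apply IH2 in HY as (Z & HZ & HYZ).
      exists Z. split; [exact HZ | now rewrite HYZ].
  - split; intros mu X HX; invert_steps; match_step.
  - split; [clear IH2 IH4 | clear IH1 IH3]; intros mu X HX; invert_steps;
      repeat match goal with
      | IH : (forall mu X, step ?P mu X -> _), H : step ?P _ _ |- _ =>
          apply IH in H as (? & ? & ?)
      end; match_step.
  (* Swapping the partners of a communication makes [co eta] the leading prefix, hence the appeal to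
     [co_involutive]. *)
  - assert (Hcomm : forall (P Q : process name) mu X, step (par P Q) mu X ->
        exists Y, step (par Q P) mu Y /\ struct_cong X Y).
    { intros P0 Q0 mu X HX; invert_steps; try match_step.
      eexists; split; [eapply step_comm; [eassumption |] | apply sc_par_comm].
      rewrite co_involutive; eassumption. }
    split; intros mu X HX; apply Hcomm in HX as (Y & HY & HXY); match_step.
  - split; intros mu X HX; invert_steps; match_step.
  - split; intros mu X HX; invert_steps; match_step.
Qed.

Lemma struct_cong_step {name : Type} (P Q : process name) mu P' :
  struct_cong P Q -> step P mu P' ->
  exists Q', step Q mu Q' /\ struct_cong P' Q'.
Proof. intros H; apply (struct_cong_step_both _ _ H). Qed.

(** Transitivity blocks inversion of the congruence itself. The unique transition of a prefixed
    process, however, reveals both its label and its continuation. *)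
Lemma struct_cong_pre_inv {name : Type} (eta theta : prefix name) P Q :
  struct_cong (pre eta P) (pre theta Q) -> eta = theta /\ struct_cong P Q.
Proof.
  intros H.
  destruct (struct_cong_step _ _ _ _ H (step_pre eta P)) as (Q' & HQ & HPQ).
  now inversion HQ; subst.
Qed.

(** A visible action comes from a single factor and leaves the others untouched, so transitions can
    be read off the multiset of factors. *)
Lemma visible_step_factor {name : Type} (P : process name) eta P' :
  step P (visible eta) P' ->
  exists T R, struct_cong P (par (pre eta T) R) /\ struct_cong P' (par T R).
Proof.
  intros H; remember (visible eta) as mu eqn:E.
  induction H as [eta' P | | mu P P' Q H IH | mu P P' Q H IH];
    try discriminate.
  - injection E as ->. exists P, inert. now rewrite !sc_par_inert.
  - destruct (IH E) as (T & R & H1 & H2). exists T, (par R Q).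
    now rewrite H1, H2, !sc_par_assoc.
  - destruct (IH E) as (T & R & H1 & H2). exists T, (par Q R).
    rewrite H1, H2. split; apply par_left_comm.
Qed.

(** * Bisimilarity is a congruence and contains distribution *)

Lemma bisimilar_step {name : Type} (P Q : process name) mu P' :
  bisimilar P Q -> step P mu P' ->
  exists Q', step Q mu Q' /\ bisimilar P' Q'.
Proof.
  intros (R & HR & HPQ) HP.
  destruct (proj2 HR _ _ _ _ HPQ HP) as (Q' & HQ & HPQ').
  exists Q'. split; [exact HQ |]. now exists R.
Qed.

Lemma bisimilar_sym {name : Type} (P Q : process name) :
  bisimilar P Q -> bisimilar Q P.
Proof.
  intros (R & HR & HPQ). exists R. split; [exact HR | now apply (proj1 HR)].
Qed.

Lemma struct_cong_bisimilar {name : Type} (P Q : process name) :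
  struct_cong P Q -> bisimilar P Q.
Proof.
  intros H. exists struct_cong. split; [| exact H].
  split; [exact sc_sym |].
  intros P0 Q0 mu P' HPQ. now apply struct_cong_step.
Qed.

Lemma bisimilar_trans {name : Type} (P Q R : process name) :
  bisimilar P Q -> bisimilar Q R -> bisimilar P R.
Proof.
  intros H1 H2.
  exists (fun X Z => exists Y, bisimilar X Y /\ bisimilar Y Z).
  split; [split | now exists Q].
  - intros X Z (Y & HXY & HYZ). exists Y.
    split; now apply bisimilar_sym.
  - intros X Z mu X' (Y & HXY & HYZ) HX.
    destruct (bisimilar_step _ _ _ _ HXY HX) as (Y' & HY & HXY').
    destruct (bisimilar_step _ _ _ _ HYZ HY) as (Z' & HZ & HYZ').
    exists Z'. split; [exact HZ | now exists Y'].
Qed.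

#[local] Instance bisimilar_equivalence {name : Type} :
  Equivalence (@bisimilar name).
Proof.
  split.
  - intros P. apply struct_cong_bisimilar, sc_refl.
  - exact bisimilar_sym.
  - exact bisimilar_trans.
Qed.

Lemma bisimilar_intro {name : Type} (P Q : process name) :
  (forall mu P', step P mu P' -> exists Q', step Q mu Q' /\ bisimilar P' Q') ->
  (forall mu Q', step Q mu Q' -> exists P', step P mu P' /\ bisimilar Q' P') ->
  bisimilar P Q.
Proof.
  intros H1 H2.
  (* Bisimilarity enlarged by the pair and its converse; the first move from the new pairs lands
     back in bisimilarity. *)
  exists (fun X Y => bisimilar X Y \/ (X = P /\ Y = Q) \/ (X = Q /\ Y = P)).
  split; [split | now auto].
  - intros X Y [H | H]; [left; now apply bisimilar_sym | tauto].
  - intros X Y mu X' [H | [[-> ->] | [-> ->]]] HX.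
    + destruct (bisimilar_step _ _ _ _ H HX) as (Y' & HY & HXY). eauto.
    + destruct (H1 _ _ HX) as (Y' & HY & HXY). eauto.
    + destruct (H2 _ _ HX) as (Y' & HY & HXY). eauto.
Qed.

Lemma bisimilar_pre {name : Type} (eta : prefix name) P Q :
  bisimilar P Q -> bisimilar (pre eta P) (pre eta Q).
Proof.
  intros H. apply bisimilar_intro; intros mu X HX; invert_steps.
  - exists Q. auto with ccs.
  - exists P. split; [auto with ccs | now symmetry].
Qed.

Lemma bisimilar_par {name : Type} (P P' Q Q' : process name) :
  bisimilar P P' -> bisimilar Q Q' -> bisimilar (par P Q) (par P' Q').
Proof.
  intros HP HQ.
  exists (fun X Y => exists A A' B B',
    X = par A B /\ Y = par A' B' /\ bisimilar A A' /\ bisimilar B B').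
  split; [split | now exists P, P', Q, Q'].
  - intros X Y (A & A' & B & B' & -> & -> & HA & HB).
    exists A', A, B', B. repeat split; now symmetry.
  - intros X Y mu X' (A & A' & B & B' & -> & -> & HA & HB) HX.
    invert_steps;
      repeat match goal with
      | H : step A _ _ |- _ =>
          destruct (bisimilar_step _ _ _ _ HA H) as (? & ? & ?); clear H
      | H : step B _ _ |- _ =>
          destruct (bisimilar_step _ _ _ _ HB H) as (? & ? & ?); clear H
      end;
      eexists; (split; [solve [eauto with ccs] |]);
      do 4 eexists; eauto.
Qed.

(** Every copy offers only [eta], which differs from [co eta], so no two copies communicate; firing
    any copy gives the same residual up to reordering. *)
Lemma copies_step {name : Type} (eta : prefix name) R k mu X :
  step (copies (S k) (pre eta R)) mu X ->
  mu = visible eta /\ struct_cong X (par R (copies k (pre eta R))).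
Proof.
  revert mu X. induction k as [| k IH]; intros mu X HX.
  - simpl in HX. invert_steps. split; reflexivity.
  - remember (S k) as k' eqn:Ek.
    change (copies (S k') (pre eta R))
      with (par (pre eta R) (copies k' (pre eta R))) in HX.
    inversion HX; clear HX; subst; invert_steps.
    + match goal with H : step _ (visible (co _)) _ |- _ =>
        apply IH in H as [H _]; injection H as H end.
      exfalso. eapply co_neq; eassumption.
    + split; reflexivity.
    + match goal with H : step _ mu _ |- _ => apply IH in H as [-> H] end.
      split; [reflexivity |].
      simpl. match goal with H : struct_cong _ _ |- _ => rewrite H end.
      apply par_left_comm.
Qed.

Lemma distribution_law {name : Type} (eta : prefix name) R k :
  bisimilar (pre eta (par R (copies k (pre eta R)))) (copies (S k) (pre eta R)).
Proof.
  apply bisimilar_intro; intros mu X HX.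
  - invert_steps. eexists; split; [simpl; auto with ccs | reflexivity].
  - apply copies_step in HX as [-> HX].
    eexists; split; [apply step_pre | now apply struct_cong_bisimilar].
Qed.

Lemma dist_subterm_bisimilar {name : Type} (P Q : process name) :
  dist_subterm P Q -> bisimilar P Q.
Proof.
  induction 1 as [eta R k Hk | | |].
  - rewrite Nat.add_1_r. apply distribution_law.
  - now apply bisimilar_pre.
  - now apply bisimilar_par.
  - now apply bisimilar_par.
Qed.

Lemma nf_bisimilar {name : Type} (P : process name) : bisimilar P (nf P).
Proof.
  destruct (nf_spec P) as [H _].
  induction H as [P Q (P1 & P2 & H1 & H2 & H3) | P | P Q R].
  - apply struct_cong_bisimilar in H1, H3.
    apply dist_subterm_bisimilar in H2.
    now rewrite H1, H2.
  - reflexivity.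
  - etransitivity; eassumption.
Qed.

(** * Processes as multisets of prefixed factors *)

(** Multiplicity in the multiset of top-level factors, taken up to congruence, which is decided
    classically. It vanishes unless [t] is congruent to a prefixed process. *)
Fixpoint mult {name : Type} (t P : process name) : nat :=
  match P with
  | inert => 0
  | pre eta P =>
      if excluded_middle_informative (struct_cong t (pre eta P)) then 1 else 0
  | par P Q => mult t P + mult t Q
  end.

Lemma mult_struct_cong {name : Type} (t P Q : process name) :
  struct_cong P Q -> mult t P = mult t Q.
Proof.
  induction 1 as [| | | eta P Q H _ | | | |]; simpl; try lia.
  apply (sc_pre eta) in H.
  do 2 destruct excluded_middle_informative; auto; exfalso; eauto using sc_trans, sc_sym.
Qed.

Lemma mult_par {name : Type} (t P Q : process name) :
  mult t (par P Q) = mult t P + mult t Q.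
Proof. reflexivity. Qed.

Lemma mult_factor {name : Type} (t P : process name) eta T R :
  struct_cong P (par (pre eta T) R) ->
  mult t P = mult t (pre eta T) + mult t R.
Proof. intros H. now rewrite (mult_struct_cong t _ _ H). Qed.

Lemma mult_pre_eq {name : Type} (t : process name) eta P :
  struct_cong t (pre eta P) -> mult t (pre eta P) = 1.
Proof. intros H; simpl; now destruct excluded_middle_informative. Qed.

Lemma mult_pre_neq {name : Type} (t : process name) eta P :
  ~ struct_cong t (pre eta P) -> mult t (pre eta P) = 0.
Proof. intros H; simpl; now destruct excluded_middle_informative. Qed.

Lemma mult_pos {name : Type} (t P : process name) :
  0 < mult t P ->
  exists eta T R, struct_cong t (pre eta T) /\ struct_cong P (par (pre eta T) R).
Proof.
  induction P as [| eta P _ | P IHP Q IHQ]; simpl; intros H.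
  - lia.
  - destruct excluded_middle_informative as [Ht |]; [| lia].
    exists eta, P, inert. now rewrite sc_par_inert.
  - assert (0 < mult t P \/ 0 < mult t Q) as [HP | HQ] by lia.
    + destruct (IHP HP) as (eta & T & R & Ht & HR). exists eta, T, (par R Q).
      now rewrite HR, sc_par_assoc.
    + destruct (IHQ HQ) as (eta & T & R & Ht & HR). exists eta, T, (par P R).
      split; [exact Ht |]. rewrite HR. apply par_left_comm.
Qed.

Lemma mult_le_size {name : Type} (t P : process name) : mult t P <= size P.
Proof.
  induction P; simpl; try destruct excluded_middle_informative; lia.
Qed.

Lemma struct_cong_size {name : Type} (P Q : process name) :
  struct_cong P Q -> size P = size Q.
Proof. apply struct_cong_measures. Qed.

Lemma mult_large {name : Type} (t P : process name) :
  size P < size t -> mult t P = 0.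
Proof.
  intros H. destruct (Nat.eq_0_gt_0_cases (mult t P)) as [| Hpos]; auto.
  apply mult_pos in Hpos as (eta & T & R & Ht & HP).
  apply struct_cong_size in Ht, HP. simpl in *; lia.
Qed.

Lemma inert_or_factor {name : Type} (P : process name) :
  struct_cong P inert \/
  exists eta T R, struct_cong P (par (pre eta T) R).
Proof.
  induction P as [| eta P _ | P IHP Q IHQ].
  - now left.
  - right. exists eta, P, inert. now rewrite sc_par_inert.
  - destruct IHP as [HP | (eta & T & R & HP)].
    + assert (HPQ : struct_cong (par P Q) Q)
        by now rewrite HP, sc_par_comm, sc_par_inert.
      destruct IHQ as [HQ | (eta & T & R & HQ)].
      * left. now rewrite HPQ.
      * right. exists eta, T, R. now rewrite HPQ.
    + right. exists eta, T, (par R Q). now rewrite HP, sc_par_assoc.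
Qed.

(** A factor of [P] has positive multiplicity in [Q], so it can be split off both sides; the
    remainders still have equal multiplicities and are smaller. *)
Lemma mult_ext {name : Type} (P Q : process name) :
  (forall t, mult t P = mult t Q) -> struct_cong P Q.
Proof.
  revert Q.
  induction P as [P IH] using (well_founded_induction (well_founded_ltof _ size)).
  intros Q H.
  destruct (inert_or_factor P) as [HP | (eta & T & R & HP)].
  - destruct (inert_or_factor Q) as [HQ | (eta & T & R & HQ)].
    + now rewrite HP, HQ.
    + specialize (H (pre eta T)).
      rewrite (mult_struct_cong _ _ _ HP), (mult_factor _ _ _ _ _ HQ) in H.
      rewrite mult_pre_eq in H by reflexivity. simpl in H. lia.
  - assert (HQ : 0 < mult (pre eta T) Q).
    { rewrite <- H, (mult_factor _ _ _ _ _ HP).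
      rewrite mult_pre_eq by reflexivity. lia. }
    apply mult_pos in HQ as (theta & U & S & HTU & HQ).
    rewrite <- HTU in HQ. rewrite HP, HQ.
    apply sc_par; [reflexivity |].
    apply IH.
    + apply struct_cong_size in HP. unfold ltof; simpl in *; lia.
    + intros t. specialize (H t).
      rewrite (mult_factor _ _ _ _ _ HP), (mult_factor _ _ _ _ _ HQ) in H.
      lia.
Qed.

(** * Reduced processes *)

(** A syntax-directed form of irreducibility: redexes are sought at each prefix, up to congruence.
    Factors and continuations then inherit it by computation. *)
Fixpoint reduced {name : Type} (P : process name) : Prop :=
  match P with
  | inert => True
  | pre eta P =>
      reduced P /\
      forall R k, 1 <= k -> ~ struct_cong P (par R (copies k (pre eta R)))
  | par P Q => reduced P /\ reduced Q
  end.

Lemma reduced_struct_cong {name : Type} (P Q : process name) :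
  struct_cong P Q -> (reduced P <-> reduced Q).
Proof.
  induction 1 as [| | | eta P Q H IH | | | |]; simpl; try tauto.
  rewrite IH. split; intros [HR Hk]; split; auto; intros R k Hk1.
  - rewrite <- H. now apply Hk.
  - rewrite H. now apply Hk.
Qed.

Lemma dist_under_pre {name : Type} (eta : prefix name) P P' :
  dist P P' -> dist (pre eta P) (pre eta P').
Proof.
  intros (P1 & P2 & H1 & H2 & H3). exists (pre eta P1), (pre eta P2).
  auto using sc_pre, dist_pre.
Qed.

Lemma dist_under_par {name : Type} (P P' Q : process name) :
  dist P P' -> dist (par P Q) (par P' Q) /\ dist (par Q P) (par Q P').
Proof.
  intros (P1 & P2 & H1 & H2 & H3).
  split; [exists (par P1 Q), (par P2 Q) | exists (par Q P1), (par Q P2)];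
    auto using sc_par, sc_refl, dist_par_l, dist_par_r.
Qed.

Lemma irreducible_reduced {name : Type} (P : process name) :
  (forall P', ~ dist P P') -> reduced P.
Proof.
  induction P as [| eta P IH | P IHP Q IHQ]; simpl; intros H; auto.
  - split.
    + apply IH. intros P' HP. eapply H, dist_under_pre, HP.
    + intros R k Hk HP. eapply H.
      eexists _, _. split; [apply sc_pre, HP |].
      split; [now apply dist_here | reflexivity].
  - split; [apply IHP | apply IHQ]; intros X HX.
    + apply (H (par X Q)). now apply dist_under_par.
    + apply (H (par P X)). now apply dist_under_par.
Qed.

(** * Comparing multiplicities through matched transitions *)

Lemma exists_maximal {A : Type} (D : A -> Prop) (f : A -> nat) (b : nat) :
  (exists x, D x) -> (forall x, D x -> f x <= b) ->
  exists x, D x /\ forall y, D y -> f y <= f x.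
Proof.
  intros Hex. induction b as [| b IH]; intros Hb.
  - destruct Hex as [x Hx]. exists x. split; [exact Hx |].
    intros y Hy. apply Hb in Hy. lia.
  - destruct (classic (exists x, D x /\ f x = S b)) as [(x & Hx & E) | Hno].
    + exists x. rewrite E. auto.
    + apply IH. intros x Hx. specialize (Hb x Hx).
      destruct (Nat.eq_dec (f x) (S b)); [exfalso; eauto | lia].
Qed.

Lemma factors_cong_copies {name : Type} (v S : process name) :
  (forall eta W R, struct_cong S (par (pre eta W) R) -> struct_cong v (pre eta W)) ->
  exists k, struct_cong S (copies k v).
Proof.
  induction S as [S IH] using (well_founded_induction (well_founded_ltof _ size)).
  intros H.
  destruct (inert_or_factor S) as [HS | (eta & W & R & HS)].
  - now exists 0.
  - destruct (IH R) as [k Hk].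
    + apply struct_cong_size in HS. unfold ltof; simpl in *; lia.
    + intros theta X R' HR. eapply H. rewrite HS, HR. apply par_left_comm.
    + exists (Datatypes.S k). simpl. now rewrite HS, Hk, <- (H _ _ _ HS).
Qed.

(** What bisimilarity yields on visible transitions once bisimilar residuals are known to be
    congruent. *)
Definition simulates_factors {name : Type} (P Q : process name) : Prop :=
  forall eta T R, struct_cong P (par (pre eta T) R) ->
  exists U S, struct_cong Q (par (pre eta U) S) /\
    struct_cong (par T R) (par U S).

Lemma mult_par_cong {name : Type} (t T R U S : process name) :
  struct_cong (par T R) (par U S) ->
  mult t T + mult t R = mult t U + mult t S.
Proof. apply (mult_struct_cong t). Qed.

Lemma largest_difference_is_power {name : Type} (P Q t : process name) eta T R :
  simulates_factors P Q ->
  (forall s, size t < size s -> mult s P = mult s Q) ->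
  mult t Q < mult t P ->
  struct_cong P (par (pre eta T) R) -> struct_cong t (pre eta T).
Proof.
  intros Hsim Hlarge Hlt HP.
  apply NNPP; intros Hnt.
  (* Among the factors of [P] other than [t], choose one whose continuation [U] holds the most
     copies of [t]; [size P] bounds that number. *)
  destruct (exists_maximal
    (fun x : prefix name * process name => let (eta, T) := x in
       ~ struct_cong t (pre eta T) /\
       exists R, struct_cong P (par (pre eta T) R))
    (fun x => mult t (snd x)) (size P)) as ([theta U] & [HtU [X HX]] & Hmax).
  - now exists (eta, T); eauto.
  - intros [theta U] [_ [X HX]]. simpl.
    apply struct_cong_size in HX. simpl in HX.
    pose proof (mult_le_size t U). lia.
  - destruct (Hsim _ _ _ HX) as (V & S & HQ & HVS).
    pose proof (mult_factor t _ _ _ _ HX) as E1.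
    pose proof (mult_factor t _ _ _ _ HQ) as E2.
    apply (mult_par_cong t) in HVS.
    rewrite (mult_pre_neq _ _ _ HtU) in E1.
    (* Firing [U] keeps all [mult t P] copies and adds [mult t U]. Since [S] supplies at most
       [mult t Q], which is less than [mult t P], [V] must hold more copies than [U], in particular
       at least one. *)
    assert (HtV : size t <= size V).
    { destruct (Nat.le_gt_cases (size t) (size V)) as [| Hs]; auto.
      apply mult_large in Hs. lia. }
    assert (Hneq : ~ struct_cong t (pre theta V)).
    { intros E. apply struct_cong_size in E. simpl in E. lia. }
    rewrite (mult_pre_neq _ _ _ Hneq) in E2.
    (* This factor is strictly larger than [t], so it occurs in [P] as often as in [Q] and competes
       with [U] for the maximum. *)
    assert (HvP : 0 < mult (pre theta V) P).
    { rewrite Hlarge by (simpl; lia). rewrite (mult_factor _ _ _ _ _ HQ).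
      rewrite mult_pre_eq by reflexivity. lia. }
    apply mult_pos in HvP as (theta' & V' & Y & HVV & HPV).
    rewrite <- HVV in HPV.
    specialize (Hmax (theta, V) (conj Hneq (ex_intro _ Y HPV))).
    simpl in Hmax. lia.
Qed.

Lemma largest_difference_absurd {name : Type} (P Q t : process name) :
  reduced P -> simulates_factors P Q -> simulates_factors Q P ->
  (forall s, size t < size s -> mult s P = mult s Q) ->
  mult t Q < mult t P -> False.
Proof.
  intros Hred HPQ HQP Hlarge Hlt.
  assert (Hpow : forall eta T R, struct_cong P (par (pre eta T) R) ->
    struct_cong t (pre eta T)).
  { intros eta T R. now apply largest_difference_is_power with Q. }
  (* A factor of [Q] larger than [t] would also occur in [P], all of whose factors are [t]. Hence
     [V] and [U] are too small to contain [t], and the residuals have [mult t S] and [mult t P - 1]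
     copies. Were the factor [t] itself, the multiplicities in [P] and [Q] would agree. *)
  assert (HtQ : forall theta V S, struct_cong Q (par (pre theta V) S) ->
    ~ struct_cong t (pre theta V) /\ mult t S + 1 = mult t P).
  { intros theta V S HQ.
    assert (Hsize : size (pre theta V) <= size t).
    { destruct (Nat.le_gt_cases (size (pre theta V)) (size t)) as [| Hs]; auto.
      pose proof (mult_factor (pre theta V) _ _ _ _ HQ) as E.
      rewrite mult_pre_eq in E by reflexivity.
      rewrite <- Hlarge in E by exact Hs.
      assert (Hpos : 0 < mult (pre theta V) P) by lia.
      apply mult_pos in Hpos as (theta' & V' & Y & HVV & HP).
      apply Hpow in HP. apply struct_cong_size in HVV, HP. lia. }
    destruct (HQP _ _ _ HQ) as (U & R & HP & HVS).
    apply (mult_par_cong t) in HVS.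
    pose proof (Hpow _ _ _ HP) as HtU.
    pose proof (mult_factor t _ _ _ _ HP) as E1.
    pose proof (mult_factor t _ _ _ _ HQ) as E2.
    rewrite (mult_pre_eq _ _ _ HtU) in E1.
    apply struct_cong_size in HtU. simpl in HtU, Hsize.
    rewrite (mult_large t U), (mult_large t V) in HVS by lia.
    split; [| lia].
    intros HtV. rewrite (mult_pre_eq _ _ _ HtV) in E2. lia. }
  assert (HtQ0 : mult t Q = 0).
  { destruct (Nat.eq_0_gt_0_cases (mult t Q)) as [| Hpos]; auto.
    apply mult_pos in Hpos as (theta & V & S & HV & HQ).
    now apply HtQ in HQ as [HQ _]. }
  assert (Hpos : 0 < mult t P) by lia.
  apply mult_pos in Hpos as (eta & T & R0 & HtT & HP).
  destruct (HPQ _ _ _ HP) as (V & S & HQ & HVS).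
  destruct (HtQ _ _ _ HQ) as [HtV E].
  assert (HtP : mult t P = 1).
  { rewrite (mult_factor t _ _ _ _ HQ) in HtQ0. lia. }
  (* A further factor would be a second copy of [t], so [P] is a single prefix and its only residual
     is [T]. *)
  assert (Hsingle : forall theta U R, struct_cong P (par (pre theta U) R) ->
    theta = eta /\ struct_cong (par U R) T).
  { intros theta U R HPU.
    pose proof (Hpow _ _ _ HPU) as HtU.
    pose proof (mult_factor t _ _ _ _ HPU) as E1.
    rewrite (mult_pre_eq _ _ _ HtU) in E1.
    rewrite HtT in HtU. apply struct_cong_pre_inv in HtU as [<- HTU].
    split; [reflexivity |].
    destruct (inert_or_factor R) as [HR | (theta & W & R' & HR)].
    - now rewrite HR, sc_par_inert.
    - exfalso.
      pose proof (mult_factor t _ _ _ _ HR) as E2.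
      rewrite (mult_pre_eq t theta W) in E2; [lia |].
      apply Hpow with (par (pre eta U) R').
      rewrite HPU, HR. apply par_left_comm. }
  assert (HT : struct_cong T (par V S)).
  { destruct (Hsingle _ _ _ HP) as [_ HT]. now rewrite <- HVS. }
  (* Firing another factor [pre theta W] of [Q] also leads to [T], and it leaves [pre eta V] in
     place. Firing [pre eta V] must therefore leave a copy of it too; [V] is too small to hold one,
     so equating the counts forces [pre theta W] to be one. *)
  destruct (factors_cong_copies (pre eta V) S) as [k Hk].
  { intros theta W S' HS.
    assert (HQ' : struct_cong Q (par (pre theta W) (par (pre eta V) S'))).
    { rewrite HQ, HS. apply par_left_comm. }
    destruct (HQP _ _ _ HQ') as (U & R & HP' & HWU).
    apply Hsingle in HP' as [-> HU].
    rewrite HU, HT, HS in HWU.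
    apply (mult_struct_cong (pre eta V)) in HWU. rewrite !mult_par in HWU.
    rewrite mult_pre_eq in HWU by reflexivity.
    rewrite (mult_large _ V) in HWU by (simpl; lia).
    apply NNPP; intros Hneq. rewrite (mult_pre_neq _ _ _ Hneq) in HWU. lia. }
  apply (reduced_struct_cong _ _ HP) in Hred as [[_ Hred] _].
  (* With no copies, [T] is [V] and [t] would be a factor of [Q]; with at least one, [pre eta T] is
     a redex. *)
  destruct k as [| k].
  - apply HtV. now rewrite HtT, HT, Hk, sc_par_inert.
  - apply (Hred V (Datatypes.S k)); [lia |]. now rewrite HT, Hk.
Qed.

Lemma simulates_factors_cong {name : Type} (P Q : process name) :
  reduced P -> reduced Q -> simulates_factors P Q -> simulates_factors Q P ->
  struct_cong P Q.
Proof.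
  intros HP HQ HPQ HQP. apply mult_ext. apply NNPP; intros H.
  apply not_all_ex_not in H.
  (* Anything larger than [size P + size Q] occurs in neither process, so a largest difference
     exists. *)
  destruct (exists_maximal (fun t => mult t P <> mult t Q) size
    (size P + size Q) H) as (t & Ht & Hmax).
  - intros s Hs. apply Nat.nlt_ge; intros Hsize. apply Hs.
    rewrite !mult_large; lia.
  - assert (Hlarge : forall s, size t < size s -> mult s P = mult s Q).
    { intros s Hs. apply NNPP; intros Hneq. apply Hmax in Hneq. lia. }
    assert (mult t Q < mult t P \/ mult t P < mult t Q) as [Hlt | Hlt] by lia.
    + now apply (largest_difference_absurd P Q t).
    + apply (largest_difference_absurd Q P t); auto.
      intros s Hs. symmetry. now apply Hlarge.
Qed.

(** * Bisimilar reduced processes are congruent *)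

Lemma bisimilar_factor {name : Type} (P Q : process name) eta T R :
  bisimilar P Q -> struct_cong P (par (pre eta T) R) ->
  exists U S, struct_cong Q (par (pre eta U) S) /\
    bisimilar (par T R) (par U S).
Proof.
  intros HPQ HP. apply struct_cong_bisimilar in HP.
  rewrite HP in HPQ.
  destruct (bisimilar_step _ _ _ _ HPQ (step_par_l _ _ _ R (step_pre eta T)))
    as (Q' & HQ & HTR).
  apply visible_step_factor in HQ as (U & S & HQ & HUS).
  exists U, S. split; [exact HQ |].
  apply struct_cong_bisimilar in HUS. now rewrite <- HUS.
Qed.

Lemma reduced_bisimilar_cong {name : Type} (P Q : process name) :
  reduced P -> reduced Q -> bisimilar P Q -> struct_cong P Q.
Proof.
  revert Q.
  induction P as [P IH] using (well_founded_induction (well_founded_ltof _ size)).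
  intros Q HP HQ HPQ.
  (* Residuals of reduced processes are reduced and firing removes one prefix, so the induction
     hypothesis upgrades bisimilar residuals to congruent ones. *)
  assert (IH' : forall eta T R U S,
    struct_cong P (par (pre eta T) R) -> struct_cong Q (par (pre eta U) S) ->
    bisimilar (par T R) (par U S) -> struct_cong (par T R) (par U S)).
  { intros eta T R U S HTR HUS H.
    apply (reduced_struct_cong _ _ HTR) in HP as [[HT _] HR].
    apply (reduced_struct_cong _ _ HUS) in HQ as [[HU _] HS].
    apply IH; [| now split | now split | exact H].
    apply struct_cong_size in HTR. unfold ltof; simpl in *; lia. }
  apply simulates_factors_cong; auto.
  - intros eta T R HTR.
    destruct (bisimilar_factor _ _ _ _ _ HPQ HTR) as (U & S & HUS & H).
    exists U, S. split; [exact HUS | now apply (IH' eta)].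
  (* When [Q] moves first, the answer is still a residual of [P], so the induction on the size of
     [P] covers this direction as well. *)
  - intros eta U S HUS. apply bisimilar_sym in HPQ.
    destruct (bisimilar_factor _ _ _ _ _ HPQ HUS) as (T & R & HTR & H).
    exists T, R. split; [exact HTR |].
    apply sc_sym, (IH' eta); auto. now symmetry.
Qed.

Lemma nf_reduced {name : Type} (P : process name) : reduced (nf P).
Proof. apply irreducible_reduced, nf_spec. Qed.

Theorem theorem2p6 (name : Type) (name_infinite : ~ Finite name)
  (P Q : process name) :
  bisimilar P Q <-> struct_cong (nf P) (nf Q).
Proof.
  split; intros H.
  - apply reduced_bisimilar_cong; try apply nf_reduced.
    now rewrite <- !nf_bisimilar.
  - rewrite (nf_bisimilar P), (nf_bisimilar Q). now apply struct_cong_bisimilar.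
Qed.
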